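(* Let $\mathcal H_S,\mathcal H_B$ be finite-dimensional complex Hilbert spaces, let $H_0=H_S\otimes \mathbf 1+\mathbf 1\otimes H_B+H_{SB}$ be a Hermitian operator on $\mathcal H_S\otimes\mathcal H_B$ with $H_S$, $H_B$, $H_{SB}$ Hermitian, let $V=\sum_\alpha S_\alpha\otimes B_\alpha$ (finite sum) be a Hermitian operator on $\mathcal H_S\otimes\mathcal H_B$, and let $|\varphi_0\rangle\in\mathcal H_B$ be a unit vector. Let $|\psi\rangle\in\mathcal H_S$ be a unit vector lying in a decoherence-free subspace for $H_0$ and initial bath state $|\varphi_0\rangle$. Then the dynamical fidelity susceptibility $$\chi=-\frac14\,\frac{\partial^2}{\partial\varepsilon^2}\frac{\partial^2 F}{\partial t^2}\Big|_{\varepsilon=t=0}$$ of $|\psi\rangle$ under the perturbation $H=H_0+\varepsilon V$ is given by $$\chi=\mathrm{tr}(\mathbf B\,\mathbf S^T),$$ where $\mathbf S$ and $\mathbf B$ are the matrices, indexed by $\alpha,\beta$, with entries $$\mathbf S_{\alpha\beta}=\langle\psi|S_\alpha^\dagger S_\beta|\psi\rangle-\langle\psi|S_\alpha^\dagger|\psi\rangle\langle\psi|S_\beta|\psi\rangle,\qquad \mathbf B_{\alpha\beta}=\langle\varphi_0|B_\alpha^\dagger B_\beta|\varphi_0\rangle ,$$ and the trace is over the indices $\alpha$.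
   Context: Units with $\hbar=1$. For real $\varepsilon$ and $t\ge 0$ put $H=H_0+\varepsilon V$ and, with $|\Psi\rangle=|\psi\rangle\otimes|\varphi_0\rangle$, define the system state $\rho_S(\varepsilon,t)=\mathrm{tr}_B\!\left(e^{-itH}|\Psi\rangle\langle\Psi|e^{itH}\right)$, where $\mathrm{tr}_B$ is the partial trace over $\mathcal H_B$. A decoherence-free subspace (for $H_0$ and $|\varphi_0\rangle$) is a subspace $D\subset\mathcal H_S$ such that for all unit vectors $|\psi\rangle\in D$ and all $t\ge0$ one has $\rho_S(0,t)=e^{-itH_S}|\psi\rangle\langle\psi|e^{itH_S}$ and $e^{-itH_S}|\psi\rangle\in D$. The dynamical fidelity is $F=F(\varepsilon,t)=F[\rho_S(0,t),\rho_S(\varepsilon,t)]$, where for density matrices $F(\sigma,\eta)=\left[\mathrm{tr}\sqrt{\sqrt\sigma\,\eta\,\sqrt\sigma}\right]^2$. For $|\psi\rangle$ in a decoherence-free subspace this equals $\langle\psi(t)|\rho_S(\varepsilon,t)|\psi(t)\rangle$ with $|\psi(t)\rangle=e^{-itH_S}|\psi\rangle$. Derivatives in $t$ at $t=0$ may be understood as one-sided or via this last expression, which makes sense for all real $t$. *)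

(* Defs.v *)
From HB Require Import structures.
From mathcomp Require Import all_boot all_order all_algebra.
From mathcomp Require Import all_classical all_reals all_analysis.
From mathcomp Require Import complex mxtens.

Set Implicit Arguments.
Unset Strict Implicit.
Unset Printing Implicit Defensive.

Import Order.TTheory GRing.Theory Num.Theory.
Import numFieldNormedType.Exports.

Local Open Scope classical_set_scope.
Local Open Scope complex_scope.
Local Open Scope ring_scope.
Local Open Scope sesquilinear_scope.

(* A Hilbert space of dimension n is represented in an orthonormal basis: kets
   are column vectors 'cV[R[i]]_n, operators are matrices 'M[R[i]]_n, the adjoint
   is _ ^t*, and the tensor product is the Kronecker product *t of mxtens. *)

Definition expm (K : numFieldType) (n : nat) (A : 'M[K]_n) : 'M[K]_n :=
  lim (series (fun k => k`!%:R^-1 *: A ^+ k) @ \oo).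

(* For a positive semidefinite A this is its unique positive semidefinite square
   root: orthomx_spectralP diagonalises A as
   invmx (spectralmx A) *m diag_mx (spectral_diag A) *m spectralmx A,
   with spectralmx A unitary. *)
Definition sqrtm (C : numClosedFieldType) (n : nat) (A : 'M[C]_n) : 'M[C]_n :=
  invmx (spectralmx A) *m diag_mx (map_mx sqrtC (spectral_diag A))
    *m spectralmx A.

Lemma sqrtm_sqr (C : numClosedFieldType) (n : nat) (A : 'M[C]_n) :
  A \is normalmx -> sqrtm A *m sqrtm A = A.
Proof.
move=> /orthomx_spectralP AE; rewrite [RHS]AE /sqrtm !mulmxA.
rewrite mulmxK ?spectral_unit //; congr (_ *m _).
rewrite -mulmxA mulmx_diag; congr (_ *m diag_mx _).
by apply/rowP => i; rewrite !mxE -expr2 sqrtCK.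
Qed.

Section Quantum.
Variable R : realType.
Local Notation C := R[i].

Definition braket (n : nat) (phi psi : 'cV[C]_n) : C := (phi ^t* *m psi) 0 0.

Definition expect (n : nat) (psi : 'cV[C]_n) (A : 'M[C]_n) : C :=
  braket psi (A *m psi).

Definition unit_vector (n : nat) (psi : 'cV[C]_n) : Prop := braket psi psi = 1.

Definition ketbra (n : nat) (psi : 'cV[C]_n) : 'M[C]_n := psi *m psi ^t*.

Definition propagator (n : nat) (H : 'M[C]_n) (t : R) : 'M[C]_n :=
  expm (- ('i * t%:C) *: H).

Definition evolve (n : nat) (H : 'M[C]_n) (rho : 'M[C]_n) (t : R) : 'M[C]_n :=
  propagator H t *m rho *m propagator H (- t).

Definition ptraceB (n m : nat) (M : 'M[C]_(n * m)) : 'M[C]_n :=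
  \matrix_(i, j) \sum_(k < m) M (mxtens_index (i, k)) (mxtens_index (j, k)).

(* The product ket has width 1 * 1, which is convertible to 1. *)
Definition system_state (n m : nat) (H : 'M[C]_(n * m)) (psi : 'cV[C]_n)
    (phi0 : 'cV[C]_m) (t : R) : 'M[C]_n :=
  ptraceB (evolve H (ketbra (psi *t phi0 : 'cV[C]_(n * m))) t).

Definition decoherence_free (n m : nat) (HS : 'M[C]_n) (H0 : 'M[C]_(n * m))
    (phi0 : 'cV[C]_m) (D : {vspace 'cV[C]_n}) : Prop :=
  forall psi : 'cV[C]_n, psi \in D -> unit_vector psi ->
  forall t : R, 0 <= t ->
    system_state H0 psi phi0 t = evolve HS (ketbra psi) t /\
    propagator HS t *m psi \in D.

(* The trace of a square root of a positive semidefinite matrix is real, so on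
   density matrices taking the real part only changes the type. *)
Definition fidelity (n : nat) (sigma eta : 'M[C]_n) : R :=
  complex.Re ((\tr (sqrtm (sqrtm sigma *m eta *m sqrtm sigma))) ^+ 2).

Definition dynamical_fidelity (n m : nat) (H0 V : 'M[C]_(n * m))
    (psi : 'cV[C]_n) (phi0 : 'cV[C]_m) (eps t : R) : R :=
  fidelity (system_state H0 psi phi0 t)
           (system_state (H0 + eps%:C *: V) psi phi0 t).

(* Differentiation of a function of time on the domain [0, +oo[: two-sided at
   t > 0 and one-sided at t = 0. *)
Definition derivable_ge0 (f : R -> R) (t : R) : Prop :=
  cvg (h^-1 * (f (t + h) - f t) @[h --> within [set h | 0 <= t + h] 0^']).

Definition derive_ge0 (f : R -> R) (t : R) : R :=
  lim (h^-1 * (f (t + h) - f t) @[h --> within [set h | 0 <= t + h] 0^']).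

Definition d2dt2_at0 (F : R -> R -> R) (eps : R) : R :=
  derive_ge0 (derive_ge0 (F eps)) 0.

(* Limits are total operators in the library, so the existence of the iterated
   derivative is recorded separately from its value. *)
Definition susceptibility_exists (F : R -> R -> R) : Prop :=
  [/\ \forall eps \near (0 : R), \forall t \near (0 : R),
        0 <= t -> derivable_ge0 (F eps) t,
      \forall eps \near (0 : R), derivable_ge0 (derive_ge0 (F eps)) 0,
      \forall eps \near (0 : R), derivable (d2dt2_at0 F) eps 1 &
      derivable (derive1 (d2dt2_at0 F)) 0 1].

Definition susceptibility (F : R -> R -> R) : R :=
  - 4^-1 * derive1n 2 (d2dt2_at0 F) 0.

Definition Smx (n k : nat) (psi : 'cV[C]_n) (S : 'I_k -> 'M[C]_n) : 'M[C]_k :=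
  \matrix_(a, b) (expect psi ((S a) ^t* *m S b)
                  - expect psi ((S a) ^t*) * expect psi (S b)).

Definition Bmx (m k : nat) (phi0 : 'cV[C]_m) (B : 'I_k -> 'M[C]_m) : 'M[C]_k :=
  \matrix_(a, b) expect phi0 ((B a) ^t* *m B b).

End Quantum.

(* Main.v *)
Require Import Defs.
From mathcomp Require Import all_boot all_order all_algebra.
From mathcomp Require Import all_classical all_reals all_analysis.
From mathcomp Require Import complex mxtens ring.

(* Every generator H that occurs is Hermitian, so the spectral theorem turns its
   propagator into U^-1 diag(e^{-i t d}) U, and rho(t) = e^{-itH} rho e^{itH}
   satisfies rho' = -i [H, rho].  In a decoherence-free subspace the unperturbed
   system state is the pure state sigma(t) = e^{-itHS} |psi><psi| e^{itHS}, so the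
   fidelity is tr (rho_S(eps, t) sigma(t)).  Differentiating this twice in t at 0
   gives a polynomial of degree 2 in eps whose eps^2 coefficient is
   - tr ([V, [V, P]] (p (x) 1)), with p = |psi><psi| and P = p (x) |phi0><phi0|.
   Hence chi = tr ([V, [V, P]] (p (x) 1)) / 2, which by cyclicity of the trace is
   tr (V P V) - tr (V P V (p (x) 1)); expanding V = sum_a S_a (x) B_a gives the
   claim. *)

Set Implicit Arguments.
Unset Strict Implicit.
Unset Printing Implicit Defensive.

Import Order.TTheory GRing.Theory Num.Theory.
Import numFieldNormedType.Exports.

Local Open Scope classical_set_scope.
Local Open Scope complex_scope.
Local Open Scope ring_scope.
Local Open Scope sesquilinear_scope.

(** * Entrywise limits and the exponential of a diagonalised matrix *)

(** There are finitely many entries, so their separate eventual bounds hold simultaneously from some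
    index on. *)
Lemma cvg_mx_entries (K : numFieldType) m n (u : nat -> 'M[K]_(m, n))
    (l : 'M[K]_(m, n)) :
  (forall i j, (fun k => u k i j) @ \oo --> l i j) -> u @ \oo --> l.
Proof.
move=> ul; apply/cvg_ballP => e e0.
have : \forall k \near \oo, forall ij : 'I_m * 'I_n,
    ball (l ij.1 ij.2) e (u k ij.1 ij.2).
  by apply: filter_forall => -[i j] /=; move/cvg_ballP : (ul i j); exact.
by apply: filterS => k uk; split=> // i j; exact: (uk (i, j)).
Qed.

(** This is the right-hand side of [orthomx_spectralP]. Products, powers, exponentials and
    derivatives of such matrices, for a fixed [P], reduce to operations on the diagonal [d]. *)
Definition conj_diag (K : comUnitRingType) n (P : 'M[K]_n) (d : 'rV[K]_n) :=
  invmx P *m diag_mx d *m P.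

Section ConjDiag.
Variables (K : comUnitRingType) (n : nat) (P : 'M[K]_n).
Hypothesis Pu : P \in unitmx.
Implicit Types (d e : 'rV[K]_n).

Lemma conj_diagM d e :
  conj_diag P d *m conj_diag P e = conj_diag P (\row_j (d 0 j * e 0 j)).
Proof.
rewrite /conj_diag -mulmx_diag !mulmxA; congr (_ *m _ *m _).
by rewrite mulmxK.
Qed.

Lemma conj_diag_comm d e :
  conj_diag P d *m conj_diag P e = conj_diag P e *m conj_diag P d.
Proof.
by rewrite !conj_diagM; congr conj_diag; apply/rowP => j; rewrite !mxE mulrC.
Qed.

Lemma conj_diagZ c d : conj_diag P (c *: d) = c *: conj_diag P d.
Proof. by rewrite /conj_diag linearZ /= -scalemxAr -scalemxAl. Qed.

Lemma conj_diag1 : conj_diag P (const_mx 1) = 1%:M.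
Proof. by rewrite /conj_diag diag_const_mx mulmx1 mulVmx. Qed.

Lemma conj_diag_inj d e : conj_diag P d = conj_diag P e -> d = e.
Proof.
move/(congr1 (fun A => P *m A *m invmx P)); rewrite /conj_diag !mulmxA.
rewrite !mulmxK // mulmxV // !mul1mx => /matrixP de; apply/rowP => j.
by have := de j j; rewrite !mxE eqxx !mulr1n.
Qed.

Lemma conj_diagX d k :
  conj_diag P d ^+ k = conj_diag P (\row_j d 0 j ^+ k).
Proof.
elim: k => [|k IH].
  rewrite expr0 (_ : \row_j _ = const_mx 1) ?conj_diag1 //.
  by apply/rowP => j; rewrite !mxE.
rewrite exprS IH -[LHS]/(_ *m _) conj_diagM; congr (conj_diag P _).
by apply/rowP => j; rewrite !mxE exprS.
Qed.

End ConjDiag.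

Lemma adj_conj_diag (C : numClosedFieldType) n (P : 'M[C]_n) (d : 'rV[C]_n) :
  P \is unitarymx -> (conj_diag P d) ^t* = conj_diag P (map_mx Num.conj d).
Proof.
move=> Pu; rewrite /conj_diag invmx_unitary //.
by rewrite !trmx_mul !map_mxM /= !mulmxA trmxCK tr_diag_mx map_diag_mx.
Qed.

(** Powers act on the diagonal alone, so each entry of a partial sum is a fixed linear combination
    of scalar partial sums, and convergence passes through the finite sum. *)
Lemma expm_conj_diag (K : numFieldType) n (P : 'M[K]_n) (d e : 'rV[K]_n) :
  P \in unitmx ->
  (forall j, series (fun k => k`!%:R^-1 * d 0 j ^+ k) @ \oo --> e 0 j) ->
  expm (conj_diag P d) = conj_diag P e.
Proof.
move=> Pu de; apply: cvg_lim; first exact: norm_hausdorff.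
apply: cvg_mx_entries => i j.
have -> : (fun N => series (fun k => k`!%:R^-1 *: conj_diag P d ^+ k) N i j) =
    (fun N => \sum_l invmx P i l *
      series (fun k => k`!%:R^-1 * d 0 l ^+ k) N * P l j).
  apply/funext => N; rewrite /series /= summxE.
  under [LHS]eq_bigr do
    rewrite mxE conj_diagX // /conj_diag mul_mx_diag !mxE mulr_sumr.
  rewrite exchange_big /=; apply: eq_bigr => l _.
  rewrite mulr_sumr mulr_suml; apply: eq_bigr => k _.
  by rewrite !mxE; ring.
rewrite /conj_diag mul_mx_diag !mxE; under [X in _ --> X]eq_bigr do rewrite mxE.
apply: cvg_big => [|l _]; first exact: add_continuous.
by apply: cvgMl; apply: cvgMr; exact: de.
Qed.

(** * The phase e^{ix} as the sum of its power series *)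

Section ComplexExponential.
Variable R : realType.
Implicit Types x y : R.

Lemma complex_ReIm x y : x +i* y = x%:C + 'i * y%:C :> R[i].
Proof.
by apply/eqP; rewrite eq_complex /= !(mul0r, mul1r, subr0, addr0, add0r) !eqxx.
Qed.

(* R[i] has no canonical topology; the cast selects the one of numFieldType. *)
Lemma cvg_complex (u : nat -> R[i]) (l : R[i]) :
  (fun k => complex.Re (u k)) @ \oo --> complex.Re l ->
  (fun k => complex.Im (u k)) @ \oo --> complex.Im l ->
  (u : nat -> (R[i] : numFieldType)) @ \oo --> (l : (R[i] : numFieldType)).
Proof.
move=> /cvgrPdist_lt ure /cvgrPdist_lt uim; apply/cvgrPdist_lt => e e0.
(* In the order of [R[i]], [0 < e] forces a zero imaginary part, so the radius is real and can be
   shared equally between the two components. *)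
have [e' eE e'0] : exists2 e' : R, e = e'%:C & 0 < e'.
  case: e e0 => a b; rewrite ltcE /= => /andP[/eqP-> a0]; by exists a.
have e2 : 0 < e' / 2 by rewrite divr_gt0.
near=> k; rewrite eE.
have -> : l - u k = (complex.Re l - complex.Re (u k))%:C
    + 'i * (complex.Im l - complex.Im (u k))%:C.
  by rewrite -complex_ReIm; case: (l) => ? ?; case: (u k).
apply: (le_lt_trans (ler_normD _ _)); rewrite normrM normCi mul1r.
rewrite [e']splitr [ltRHS]rmorphD /= ltrD // normc_def /= expr0n /= addr0
  sqrtr_sqr ltcR.
  by near: k; exact: ure.
by near: k; exact: uim.
Unshelve. all: by end_near. Qed.

Definition cis x : R[i] := cos x +i* sin x.

(** The parity of [k] decides whether i^k is real or imaginary, hence which of the two real series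
    receives the term. *)
Lemma exp_coeff_cis x k :
  k`!%:R^-1 * ('i * x%:C) ^+ k = cos_coeff x k +i* sin_coeff x k :> R[i].
Proof.
rewrite /cos_coeff /sin_coeff /= exprMn -rmorphXn /= complex_ReIm.
have -> : k`!%:R^-1 = (k`!%:R^-1)%:C :> R[i] by rewrite fmorphV rmorph_nat.
rewrite -{2}[k]odd_double_half; case: (boolP (odd k)) => ok.
  (* The sign in [sin_coeff] has exponent [k.-1./2]; for odd [k] it agrees with the exponent [k./2]
     coming from i^k. *)
  have -> : k.-1./2 = k./2.
    by case: (k) ok => //= j /negPf jE; rewrite uphalf_half jE.
  rewrite /= !mul0r rmorph0 add0r mul1r exprD expr1 -muln2 mulnC exprM sqrCi.
  by rewrite !rmorphM !rmorphXn /= rmorphN1; ring.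
rewrite /= !mul0r rmorph0 mulr0 addr0 mul1r add0n -muln2 mulnC exprM sqrCi.
by rewrite -exprnP !rmorphM !rmorphXn /= rmorphN1; ring.
Qed.

Lemma cvg_series_cis x :
  (series (fun k => k`!%:R^-1 * ('i * x%:C) ^+ k)
    : nat -> (R[i] : numFieldType)) @ \oo --> (cis x : (R[i] : numFieldType)).
Proof.
have seriesE N : series (fun k => k`!%:R^-1 * ('i * x%:C) ^+ k : R[i]) N
    = series (cos_coeff x) N +i* series (sin_coeff x) N.
  rewrite /series /= complex_ReIm !rmorph_sum mulr_sumr -big_split /=.
  by apply: eq_bigr => k _; rewrite exp_coeff_cis complex_ReIm.
apply: cvg_complex.
- rewrite (_ : (fun _ => _) = series (cos_coeff x)); last first.
    by apply/funext => N; rewrite seriesE.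
  (* [cos x] unlocks to the limit of this very series, so only its convergence remains. *)
  by rewrite /= unlock; exact: is_cvg_series_cos_coeff.
- rewrite (_ : (fun _ => _) = series (sin_coeff x)); last first.
    by apply/funext => N; rewrite seriesE.
  by rewrite /= unlock; exact: is_cvg_series_sin_coeff.
Qed.

Lemma cis0 : cis 0 = 1.
Proof. by rewrite /cis cos0 sin0. Qed.

Lemma cisNK x : cis (- x) * cis x = 1.
Proof.
rewrite /cis cosN sinN; apply/eqP; rewrite eq_complex /=.
apply/andP; split; apply/eqP; last by ring.
by rewrite mulNr opprK -!expr2 cos2Dsin2.
Qed.

Lemma conj_cis x : (cis x)^*%C = cis (- x).
Proof. by rewrite /cis cosN sinN. Qed.

End ComplexExponential.

(** * Derivatives of complex and matrix valued functions of a real variable *)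

Section ComplexDerivative.
Variable R : realType.
Implicit Types (t : R) (f g : R -> R[i]).

Lemma Re_add (x y : R[i]) : complex.Re (x + y) = complex.Re x + complex.Re y.
Proof. by case: x y => ? ? []. Qed.

Lemma Im_add (x y : R[i]) : complex.Im (x + y) = complex.Im x + complex.Im y.
Proof. by case: x y => ? ? []. Qed.

Lemma Re_mul (x y : R[i]) : complex.Re (x * y) =
  complex.Re x * complex.Re y - complex.Im x * complex.Im y.
Proof. by case: x y => ? ? []. Qed.

Lemma Im_mul (x y : R[i]) : complex.Im (x * y) =
  complex.Re x * complex.Im y + complex.Im x * complex.Re y.
Proof. by case: x y => ? ? []. Qed.

(* R[i] is not a normed module over R, hence the componentwise definition. *)
Definition is_cderive f t (df : R[i]) :=
  is_derive t 1 (fun s => complex.Re (f s)) (complex.Re df) /\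
  is_derive t 1 (fun s => complex.Im (f s)) (complex.Im df).

Lemma is_cderive_eq f t df dg : is_cderive f t df -> df = dg -> is_cderive f t dg.
Proof. by move=> ? <-. Qed.

Lemma is_cderive_cst (c : R[i]) t : is_cderive (fun=> c) t 0.
Proof. by split; exact: is_derive_cst. Qed.

Lemma is_cderiveD f g t df dg : is_cderive f t df -> is_cderive g t dg ->
  is_cderive (fun s => f s + g s) t (df + dg).
Proof.
move=> [fr fi] [gr gi]; split.
  rewrite (_ : (fun _ => _) =
      (fun s => complex.Re (f s)) + (fun s => complex.Re (g s))).
    by rewrite Re_add; exact: is_deriveD.
  by apply/funext => s; rewrite Re_add.
rewrite (_ : (fun _ => _) =
    (fun s => complex.Im (f s)) + (fun s => complex.Im (g s))).
  by rewrite Im_add; exact: is_deriveD.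
by apply/funext => s; rewrite Im_add.
Qed.

Lemma is_cderiveM f g t df dg : is_cderive f t df -> is_cderive g t dg ->
  is_cderive (fun s => f s * g s) t (df * g t + f t * dg).
Proof.
move=> [fr fi] [gr gi]; split.
  rewrite (_ : (fun _ => _) =
      (fun s => complex.Re (f s)) * (fun s => complex.Re (g s)) -
      (fun s => complex.Im (f s)) * (fun s => complex.Im (g s))).
    apply: (is_derive_eq (is_deriveB (is_deriveM fr gr) (is_deriveM fi gi))).
    rewrite Re_add !Re_mul /GRing.scale /=.
    move: (complex.Re (f t)) (complex.Im (f t)) (complex.Re df) (complex.Im df).
    move: (complex.Re (g t)) (complex.Im (g t)) (complex.Re dg) (complex.Im dg).
    by move=> *; ring.
  by apply/funext => s; rewrite Re_mul.
rewrite (_ : (fun _ => _) =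
    (fun s => complex.Re (f s)) * (fun s => complex.Im (g s)) +
    (fun s => complex.Im (f s)) * (fun s => complex.Re (g s))).
  apply: (is_derive_eq (is_deriveD (is_deriveM fr gi) (is_deriveM fi gr))).
  rewrite Im_add !Im_mul /GRing.scale /=.
  move: (complex.Re (f t)) (complex.Im (f t)) (complex.Re df) (complex.Im df).
  move: (complex.Re (g t)) (complex.Im (g t)) (complex.Re dg) (complex.Im dg).
  by move=> *; ring.
by apply/funext => s; rewrite Im_mul.
Qed.

Lemma is_cderive_sum (I : Type) (r : seq I) (F : I -> R -> R[i])
    (dF : I -> R[i]) t :
  (forall i, is_cderive (F i) t (dF i)) ->
  is_cderive (fun s => \sum_(i <- r) F i s) t (\sum_(i <- r) dF i).
Proof.
move=> FdF; elim: r => [|i r IH].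
  rewrite big_nil (_ : (fun _ => _) = fun=> 0); first exact: is_cderive_cst.
  by apply/funext => s; rewrite big_nil.
rewrite big_cons (_ : (fun _ => _) = fun s => F i s + \sum_(j <- r) F j s).
  exact: is_cderiveD.
by apply/funext => s; rewrite big_cons.
Qed.

Lemma is_cderive_cis (a t : R) :
  is_cderive (fun s => cis (- (s * a))) t (- 'i * a%:C * cis (- (t * a))).
Proof.
have da : is_derive t 1 (fun s : R => - (s * a)) (- a).
  rewrite (_ : (fun _ => _) = (- a) \*: id); last first.
    by apply/funext => s /=; rewrite /GRing.scale /=; ring.
  by apply: is_derive_eq; rewrite /GRing.scale /= mulr1.
split; apply: is_derive_eq => /=; first exact: is_derive1_comp.
- rewrite !(mul0r, mul1r, mulr0, oppr0, subr0, addr0, add0r); ring.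
- exact: is_derive1_comp.
rewrite !(mul0r, mul1r, mulr0, oppr0, subr0, addr0, add0r); ring.
Qed.

Definition is_mxderive m n (F : R -> 'M[R[i]]_(m, n)) t (dF : 'M[R[i]]_(m, n)) :=
  forall i j, is_cderive (fun s => F s i j) t (dF i j).

Lemma is_mxderive_eq m n (F : R -> 'M[R[i]]_(m, n)) t dF dG :
  is_mxderive F t dF -> dF = dG -> is_mxderive F t dG.
Proof. by move=> ? <-. Qed.

Lemma is_mxderive_cst m n (C : 'M[R[i]]_(m, n)) t : is_mxderive (fun=> C) t 0.
Proof. by move=> i j; rewrite mxE; exact: is_cderive_cst. Qed.

Lemma is_mxderiveD m n (F G : R -> 'M[R[i]]_(m, n)) t dF dG :
  is_mxderive F t dF -> is_mxderive G t dG ->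
  is_mxderive (fun s => F s + G s) t (dF + dG).
Proof.
move=> dFP dGP i j; rewrite mxE.
rewrite (_ : (fun _ => _) = fun s => F s i j + G s i j).
  exact: is_cderiveD.
by apply/funext => s; rewrite mxE.
Qed.

Lemma is_mxderiveM m n p (F : R -> 'M[R[i]]_(m, n)) (G : R -> 'M[R[i]]_(n, p))
    t dF dG :
  is_mxderive F t dF -> is_mxderive G t dG ->
  is_mxderive (fun s => F s *m G s) t (dF *m G t + F t *m dG).
Proof.
move=> dFP dGP i j; rewrite !mxE -big_split /=.
rewrite (_ : (fun _ => _) = fun s => \sum_l F s i l * G s l j).
  by apply: is_cderive_sum => l; exact: is_cderiveM.
by apply/funext => s; rewrite mxE.
Qed.

Lemma is_mxderive_conj_diag n (P : 'M[R[i]]_n) (e : R -> 'rV[R[i]]_n) t de :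
  is_mxderive e t de ->
  is_mxderive (fun s => conj_diag P (e s)) t (conj_diag P de).
Proof.
move=> ede; have dde : is_mxderive (fun s => diag_mx (e s)) t (diag_mx de).
  move=> i j; rewrite mxE; case: (eqVneq i j) => [->|ij].
    rewrite (_ : (fun _ => _) = fun s => e s 0 j) //.
    by apply/funext => s; rewrite mxE eqxx.
  rewrite (_ : (fun _ => _) = fun=> 0); first exact: is_cderive_cst.
  by apply/funext => s; rewrite mxE (negPf ij).
rewrite /conj_diag; apply: is_mxderive_eq.
  apply: is_mxderiveM; last exact: is_mxderive_cst.
  by apply: is_mxderiveM; [exact: is_mxderive_cst|exact: dde].
by move: (diag_mx _) (diag_mx _) => A B; rewrite mul0mx add0r mulmx0 addr0.
Qed.

Lemma is_mxderiveN m n (F : R -> 'M[R[i]]_(m, n)) t dF :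
  is_mxderive F t dF -> is_mxderive (fun s => - F s) t (- dF).
Proof.
move=> dFP i j; rewrite (_ : (fun _ => _) = fun s => -1 * F s i j).
  apply: is_cderive_eq; first by apply: is_cderiveM; [exact: is_cderive_cst|].
  by rewrite mul0r add0r mulN1r mxE.
by apply/funext => s; rewrite mxE mulN1r.
Qed.

Lemma is_mxderive_ptraceB n m (F : R -> 'M[R[i]]_(n * m)) t dF :
  is_mxderive F t dF ->
  is_mxderive (fun s => ptraceB (F s)) t (ptraceB dF).
Proof.
move=> dFP i j; rewrite mxE (_ : (fun _ => _) = fun s =>
    \sum_l F s (mxtens_index (i, l)) (mxtens_index (j, l))).
  by apply: is_cderive_sum => l.
by apply/funext => s; rewrite mxE.
Qed.

Lemma is_cderive_trace n (F : R -> 'M[R[i]]_n) t dF :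
  is_mxderive F t dF -> is_cderive (fun s => \tr (F s)) t (\tr dF).
Proof. by move=> dFP; apply: is_cderive_sum => l. Qed.

End ComplexDerivative.

(** * Propagators of Hermitian generators *)

Section Propagator.
Variables (R : realType) (n : nat).
Implicit Types (H M : 'M[R[i]]_n) (t : R).

(** A Hermitian matrix has a unitary eigenbasis and real eigenvalues, and the exponential acts on
    the eigenvalues. A single basis thus serves all times [t], and the other lemmas of this section
    are read off from the phases. *)
Lemma propagator_conj_diag H : H \is hermsymmx ->
  exists P (d : 'I_n -> R), [/\ P \is unitarymx,
    H = conj_diag P (\row_j (d j)%:C) &
    forall t, propagator H t = conj_diag P (\row_j cis (- (t * d j)))].
Proof.
move=> Hherm; exists (spectralmx H), (fun j => complex.Re (spectral_diag H 0 j)).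
have HE : H = conj_diag (spectralmx H)
    (\row_j (complex.Re (spectral_diag H 0 j))%:C).
  rewrite {1}(orthomx_spectralP (hermitian_normalmx Hherm)).
  congr (conj_diag _ _); apply/rowP => j; rewrite mxE RRe_real //.
  exact/mxOverP/hermitian_spectral_diag_real.
split; [exact: spectral_unitarymx|exact: HE|move=> t].
move: HE; set P := spectralmx H; set d := \row_j _ => HE.
rewrite /propagator [in LHS]HE -conj_diagZ.
apply: (@expm_conj_diag _ _ _ _ _ (spectral_unit H)) => j.
rewrite !mxE.
rewrite (_ : - ('i * t%:C) * _ = 'i *
    (- (t * complex.Re (spectral_diag H 0 j)))%:C).
  exact: cvg_series_cis.
by rewrite rmorphN rmorphM /=; ring.
Qed.

Lemma propagator0 H : H \is hermsymmx -> propagator H 0 = 1%:M.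
Proof.
move=> /propagator_conj_diag[P [d [/unitarymx_unit Pu _ ->]]].
rewrite -(conj_diag1 Pu); congr (conj_diag P _).
by apply/rowP => j; rewrite !mxE mul0r oppr0 cis0.
Qed.

Lemma propagatorNK H t : H \is hermsymmx ->
  propagator H (- t) *m propagator H t = 1%:M.
Proof.
move=> /propagator_conj_diag[P [d [/unitarymx_unit Pu _ PE]]].
rewrite PE PE (conj_diagM Pu) -(conj_diag1 Pu); congr (conj_diag P _).
by apply/rowP => j; rewrite !mxE mulNr cisNK.
Qed.

Lemma adj_propagator H t : H \is hermsymmx ->
  (propagator H t) ^t* = propagator H (- t).
Proof.
move=> /propagator_conj_diag[P [d [Pu _ PE]]].
rewrite PE PE (adj_conj_diag _ Pu); congr (conj_diag P _).
by apply/rowP => j; rewrite !mxE mulNr; exact: conj_cis.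
Qed.

Lemma propagator_comm H t : H \is hermsymmx ->
  H *m propagator H t = propagator H t *m H.
Proof.
move=> /propagator_conj_diag[P [d [/unitarymx_unit Pu HE PE]]].
by rewrite PE {1 2}HE; exact: conj_diag_comm.
Qed.

(** The Schrodinger equation, checked on each phase e^{-i t d_j}, whose derivative is -i d_j times
    itself. *)
Lemma is_mxderive_propagator H t : H \is hermsymmx ->
  is_mxderive (propagator H) t (- 'i *: (H *m propagator H t)).
Proof.
move=> /propagator_conj_diag[P [d [/unitarymx_unit Pu HE PE]]].
have -> : propagator H = fun s => conj_diag P (\row_j cis (- (s * d j))).
  exact/funext.
rewrite [in X in is_mxderive _ _ X]HE (conj_diagM Pu) -conj_diagZ.
apply: is_mxderive_conj_diag => i j; rewrite !mxE mulrA.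
rewrite (_ : (fun _ => _) = fun s => cis (- (s * d j))).
  exact: is_cderive_cis.
by apply/funext => s; rewrite mxE.
Qed.

End Propagator.

(** * Evolution of states and the von Neumann equation *)

Section Evolution.
Variables (R : realType) (n : nat).
Implicit Types (H M X Y : 'M[R[i]]_n) (t : R).

Definition commutator X Y := X *m Y - Y *m X.

Lemma evolve0 H M : H \is hermsymmx -> evolve H M 0 = M.
Proof.
by move=> Hherm; rewrite /evolve oppr0 propagator0 // mul1mx mulmx1.
Qed.

Lemma evolve_ketbra H (psi : 'cV[R[i]]_n) t : H \is hermsymmx ->
  evolve H (ketbra psi) t = ketbra (propagator H t *m psi).
Proof.
move=> Hherm; rewrite /evolve -(adj_propagator _ Hherm).
move: (propagator H t) => U.
by rewrite /ketbra trmx_mul map_mxM /= !mulmxA.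
Qed.

Lemma propagator_unit_vector H (psi : 'cV[R[i]]_n) t : H \is hermsymmx ->
  unit_vector psi -> unit_vector (propagator H t *m psi).
Proof.
move=> Hherm; rewrite /unit_vector /braket => <-.
have := propagatorNK t Hherm; rewrite -(adj_propagator _ Hherm).
move: (propagator H t) => U UU.
by rewrite trmx_mul map_mxM /= mulmxA -(mulmxA (psi ^t*)) UU mulmx1.
Qed.

(** The von Neumann equation: the product rule applied to two propagators, the right one being
    generated by [- H]. *)
Lemma is_mxderive_evolve H M t : H \is hermsymmx ->
  is_mxderive (evolve H M) t (- 'i *: commutator H (evolve H M t)).
Proof.
move=> Hherm; have HN : (- H) \is hermsymmx.
  rewrite !is_hermitianmxE in Hherm *.
  by move: Hherm; rewrite !expr0 !scale1r => /eqP {1}->; rewrite linearN map_mxN.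
(* Absorbing the time reversal into the generator makes the right factor another instance of
   [is_mxderive_propagator]. *)
have propN s : propagator H (- s) = propagator (- H) s.
  rewrite /propagator; congr expm.
  by rewrite (rmorphN (real_complex R)) (mulrN 'i) opprK scalerN [in RHS]scaleNr opprK.
rewrite (_ : evolve H M = fun s => propagator H s *m M *m propagator (- H) s).
  apply: is_mxderive_eq.
    apply: is_mxderiveM; last exact: is_mxderive_propagator.
    apply: is_mxderiveM; last exact: is_mxderive_cst.
    exact: is_mxderive_propagator.
  (* Moving [- H] past its own propagator brings it to the outer right end, where the commutator has
     it. *)
  rewrite (propagator_comm t HN) /commutator /=.
  move: (propagator H t) (propagator (- H) t) => U W.
  rewrite mulmx0 addr0 mulmxN scalerN mulmxN -!scalemxAl -!scalemxAr scalerBr.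
  by rewrite !mulmxA.
by apply/funext => s; rewrite -propN.
Qed.

End Evolution.

(* Every eigenvalue d satisfies d^2 = c d, so it is 0 or c. *)
Lemma scale_sqrtm (K : numClosedFieldType) n (A : 'M[K]_n) (c : K) :
  A \is normalmx -> A *m A = c *: A -> sqrtC c *: sqrtm A = A.
Proof.
move=> /orthomx_spectralP AE AA.
suff key (P : 'M[K]_n) (d : 'rV[K]_n) : P \in unitmx -> A = conj_diag P d ->
    sqrtC c *: conj_diag P (map_mx sqrtC d) = A.
  exact: key (spectral_unit A) AE.
move=> Pu AE'; move: AA; rewrite AE' conj_diagM // -!conj_diagZ.
move=> /(conj_diag_inj Pu) /rowP dd.
congr (conj_diag P _); apply/rowP => j; have := dd j; rewrite !mxE.
move=> /eqP; rewrite -subr_eq0 -mulrBl mulf_eq0 subr_eq0.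
move=> /orP[] /eqP ->; last by rewrite sqrtC0 mulr0.
by rewrite -expr2 sqrtCK.
Qed.

(** * Fidelity with a pure state *)

Section Fidelity.
Variable R : realType.
Local Notation C := R[i].

Lemma ketbra_adj l (psi : 'cV[C]_l) : (ketbra psi) ^t* = ketbra psi.
Proof. by rewrite /ketbra trmx_mul map_mxM trmxCK. Qed.

Lemma ketbra_idem l (psi : 'cV[C]_l) : unit_vector psi ->
  ketbra psi *m ketbra psi = ketbra psi.
Proof.
move=> psi1; rewrite /ketbra mulmxA -(mulmxA psi).
by rewrite [psi ^t* *m psi]mx11_scalar -/(braket psi psi) psi1 mulmx1.
Qed.

Lemma trace_ketbra l (psi : 'cV[C]_l) (A : 'M[C]_l) :
  \tr (A *m ketbra psi) = expect psi A.
Proof. by rewrite /ketbra mulmxA mxtrace_mulC trace_mx11. Qed.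

(** The projector p is its own square root and compresses [eta] to c p with c = tr (eta p). The
    square root of c p has a trace whose square is c. *)
Lemma fidelity_ketbra n (psi : 'cV[C]_n) (eta : 'M[C]_n) :
  unit_vector psi ->
  fidelity (ketbra psi) eta = complex.Re (\tr (eta *m ketbra psi)).
Proof.
move=> psi1; set p := ketbra psi.
have p_adj : p ^t* = p := ketbra_adj psi.
have pp : p *m p = p := ketbra_idem psi1.
have trp : \tr p = 1 by rewrite mxtrace_mulC trace_mx11; exact: psi1.
have normalp (c : C) : c *: p \is normalmx.
  apply/normalmxP; rewrite linearZ /= map_mxZ p_adj.
  by rewrite -!scalemxAl -!scalemxAr scalerA scalerA mulrC.
have sqrtp : sqrtm p = p.
  have := @scale_sqrtm _ _ p 1; rewrite sqrtC1 !scale1r; apply => //.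
  by rewrite -[p]scale1r.
rewrite /fidelity sqrtp.
set c := \tr (eta *m p).
have -> : p *m eta *m p = c *: p.
  have cE : psi ^t* *m (eta *m psi) = c%:M.
    by rewrite [LHS]mx11_scalar -trace_mx11 mxtrace_mulC -mulmxA.
  rewrite /p /ketbra -!mulmxA (mulmxA eta) (mulmxA (psi ^t*)) cE.
  by rewrite mul_scalar_mx -scalemxAr.
(* Since p is idempotent, (c p)^2 = c (c p), the relation that [scale_sqrtm] requires. *)
have := scale_sqrtm (normalp c); rewrite -scalemxAl -scalemxAr pp scalerA.
move=> /(_ c); rewrite scalerA => /(_ erefl) /(congr1 mxtrace).
rewrite !mxtraceZ trp mulr1; case: (eqVneq c 0) => [->|c0] sE.
  (* For c = 0 one cannot cancel [sqrtC c]; the zero matrix satisfies the relation with constant 1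
     instead, so it is its own square root. *)
  have := @scale_sqrtm _ _ (0 *: p) 1; rewrite sqrtC1 !scale1r => -> //.
    by rewrite scale0r mxtrace0 expr0n.
  by rewrite scale0r mulmx0.
have sc0 : sqrtC c != 0 by rewrite sqrtC_eq0.
have -> : \tr (sqrtm (c *: p)) = sqrtC c.
  by apply: (mulfI sc0); rewrite sE -expr2 sqrtCK.
by rewrite sqrtCK.
Qed.

End Fidelity.

(** * Derivatives on the half-line of nonnegative times *)

Section OneSidedDerivative.
Variable R : realType.
Implicit Types (f g : R -> R) (t : R).

(** Every punctured ball of radius e around 0 contains the admissible step e / 2. Properness is what
    makes the value of [lim] in [derive_ge0] unique. *)
Lemma within_ge0_proper_filter t : 0 <= t ->
  ProperFilter (within [set h | 0 <= t + h] (0 : R)^').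
Proof.
move=> t0; split; last exact: within_filter.
move=> /nbhs_ballP[e /= e0 eA]; have e20 : 0 < e / 2 by rewrite divr_gt0.
apply: (eA (e / 2)) => /=; last by rewrite addr_ge0 // ltW.
- by rewrite /ball /= sub0r normrN gtr0_norm // ltr_pdivrMr // ltr_pMr // ltr1n.
- by rewrite gt_eqF.
Qed.

(** The quotients on this domain only evaluate [f] at nonnegative times, so a function [g]
    differentiable in the two-sided sense may replace it. This transfers closed formulas valid for t
    >= 0 to [derive_ge0]. *)
Lemma cvg_derive_ge0 f g t dg : 0 <= t -> (forall s, 0 <= s -> f s = g s) ->
  is_derive t 1 g dg ->
  h^-1 * (f (t + h) - f t) @[h --> within [set h | 0 <= t + h] 0^'] --> dg.
Proof.
move=> t0 fg [gt dgE].
have gcvg : h^-1 * (g (t + h) - g t) @[h --> 0^'] --> dg.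
  rewrite -dgE /derive; move: gt; rewrite /derivable.
  rewrite (_ : (fun h => _) = (fun h => h^-1 * (g (t + h) - g t))) //.
  by apply/funext => h /=; rewrite /GRing.scale /= mulr1 [h + t]addrC.
suff : h^-1 * (g (t + h) - g t) @[h --> within [set h | 0 <= t + h] 0^'] --> dg.
  apply: cvg_trans; apply: near_eq_cvg.
  by rewrite near_withinE; near=> h => /= th; rewrite !fg.
apply: cvg_trans gcvg; apply: cvg_app; exact: cvg_within.
Unshelve. all: by end_near. Qed.

Lemma derivable_ge0_is_derive f g t dg : 0 <= t ->
  (forall s, 0 <= s -> f s = g s) -> is_derive t 1 g dg -> derivable_ge0 f t.
Proof. by move=> t0 fg gdg; apply/cvg_ex; exists dg; exact: cvg_derive_ge0. Qed.

Lemma derive_ge0_is_derive f g t dg : 0 <= t ->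
  (forall s, 0 <= s -> f s = g s) -> is_derive t 1 g dg -> derive_ge0 f t = dg.
Proof.
move=> t0 fg gdg; have := within_ge0_proper_filter t0 => ?.
by apply: cvg_lim; [exact: Rhausdorff|exact: cvg_derive_ge0].
Qed.

End OneSidedDerivative.

(** * Bilinearity of the commutator *)

Section Commutator.
Variables (R : realType) (n : nat).
Implicit Types X Y Z : 'M[R[i]]_n.

Lemma commutatorDl X Y Z : commutator (X + Y) Z = commutator X Z + commutator Y Z.
Proof. by rewrite /commutator mulmxDl mulmxDr opprD addrACA. Qed.

Lemma commutatorDr X Y Z : commutator X (Y + Z) = commutator X Y + commutator X Z.
Proof. by rewrite /commutator mulmxDl mulmxDr opprD addrACA. Qed.

Lemma commutatorZl c X Y : commutator (c *: X) Y = c *: commutator X Y.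
Proof. by rewrite /commutator -scalemxAl -scalemxAr scalerBr. Qed.

Lemma commutatorZr c X Y : commutator X (c *: Y) = c *: commutator X Y.
Proof. by rewrite /commutator -scalemxAl -scalemxAr scalerBr. Qed.

Lemma is_mxderive_commutator X (F : R -> 'M[R[i]]_n) t dF :
  is_mxderive F t dF ->
  is_mxderive (fun s => commutator X (F s)) t (commutator X dF).
Proof.
move=> FdF; rewrite /commutator; apply: is_mxderive_eq.
  apply: is_mxderiveD.
    by apply: is_mxderiveM; [exact: is_mxderive_cst|exact: FdF].
  apply: is_mxderiveN.
  by apply: is_mxderiveM; [exact: FdF|exact: is_mxderive_cst].
by rewrite mul0mx add0r mulmx0 addr0.
Qed.

End Commutator.

(** * The pairing of a joint state with a system operator, and its time derivatives *)

Section Overlap.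
Variables (R : realType) (n m : nat).
Implicit Types (X Y M P : 'M[R[i]]_(n * m)) (Z p K : 'M[R[i]]_n).

Lemma ptraceBD X Y : ptraceB (X + Y) = ptraceB X + ptraceB Y.
Proof.
apply/matrixP => i j; rewrite !mxE -big_split /=.
by apply: eq_bigr => l _; rewrite mxE.
Qed.

Lemma ptraceBZ c X : ptraceB (c *: X) = c *: ptraceB X.
Proof.
apply/matrixP => i j; rewrite !mxE mulr_sumr.
by apply: eq_bigr => l _; rewrite mxE.
Qed.

(** For [Z] a pure state and [X] a joint state this is the fidelity of [Z] with the reduced state of
    [X]. Being bilinear, it can be differentiated factor by factor. *)
Definition overlap X Z : R[i] := \tr (ptraceB X *m Z).

Lemma overlapDl X Y Z : overlap (X + Y) Z = overlap X Z + overlap Y Z.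
Proof. by rewrite /overlap ptraceBD mulmxDl mxtraceD. Qed.

Lemma overlapZl c X Z : overlap (c *: X) Z = c * overlap X Z.
Proof. by rewrite /overlap ptraceBZ -scalemxAl mxtraceZ. Qed.

Lemma overlapZr c X Z : overlap X (c *: Z) = c * overlap X Z.
Proof. by rewrite /overlap -scalemxAr mxtraceZ. Qed.

Lemma is_cderive_overlap (F : R -> 'M[R[i]]_(n * m)) (G : R -> 'M[R[i]]_n)
    t dF dG : is_mxderive F t dF -> is_mxderive G t dG ->
  is_cderive (fun s => overlap (F s) (G s)) t
    (overlap dF (G t) + overlap (F t) dG).
Proof.
move=> FdF GdG; rewrite /overlap -mxtraceD; apply: is_cderive_trace.
by apply: is_mxderiveM => //; exact: is_mxderive_ptraceB.
Qed.

Variables (H P : 'M[R[i]]_(n * m)) (K p : 'M[R[i]]_n).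
Hypotheses (H_herm : H \is hermsymmx) (K_herm : K \is hermsymmx).

Lemma is_cderive_overlap_evolve t :
  is_cderive (fun s => overlap (evolve H P s) (evolve K p s)) t
    (- 'i * (overlap (commutator H (evolve H P t)) (evolve K p t)
           + overlap (evolve H P t) (commutator K (evolve K p t)))).
Proof.
have dE := is_mxderive_evolve P t H_herm.
have de := is_mxderive_evolve p t K_herm.
apply: is_cderive_eq; first exact: is_cderive_overlap dE de.
by rewrite overlapZl overlapZr mulrDr.
Qed.

(** The Leibniz rule is applied once more to the first derivative: the two mixed terms coincide, and
    (-i)^2 gives the overall sign. *)
Lemma is_cderive2_overlap_evolve t :
  is_cderive (fun s => - 'i *
      (overlap (commutator H (evolve H P s)) (evolve K p s)
     + overlap (evolve H P s) (commutator K (evolve K p s)))) t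
    (- (overlap (commutator H (commutator H (evolve H P t))) (evolve K p t)
      + 2 * overlap (commutator H (evolve H P t)) (commutator K (evolve K p t))
      + overlap (evolve H P t) (commutator K (commutator K (evolve K p t))))).
Proof.
have dE := is_mxderive_evolve P t H_herm.
have de := is_mxderive_evolve p t K_herm.
have dE' := is_mxderive_commutator H dE.
have de' := is_mxderive_commutator K de.
apply: is_cderive_eq.
  apply: is_cderiveM; first exact: is_cderive_cst.
  apply: is_cderiveD; first exact: is_cderive_overlap dE' de.
  exact: is_cderive_overlap dE de'.
cbv beta; move: (evolve H P t) (evolve K p t) => E e; rewrite mul0r add0r.
rewrite !commutatorZr !overlapZl !overlapZr -[RHS]mulN1r -sqrCi.
move: (overlap (commutator H (commutator H E)) e)
  (overlap (commutator H E) (commutator K e))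
  (overlap E (commutator K (commutator K e))) => a b c.
by ring.
Qed.

End Overlap.

(** * Trace identities on the tensor product *)

(** The double commutator is VVP - 2 VPV + PVV. As [Q] absorbs [P] on either side, each outer term
    traces to tr (VPV) by cyclicity. *)
Lemma trace_double_commutator (K : comNzRingType) n (V P Q : 'M[K]_n) :
  P *m Q = P -> Q *m P = P ->
  \tr ((V *m (V *m P - P *m V) - (V *m P - P *m V) *m V) *m Q) =
  2 * (\tr (V *m P *m V) - \tr (V *m P *m V *m Q)).
Proof.
move=> PQ QP; rewrite !(mulmxBl, mulmxBr) !mulmxA -(mulmxA (V *m V) P) PQ.
rewrite !raddfB /= (mxtrace_mulC (P *m V *m V)) !mulmxA QP.
have -> : \tr (V *m V *m P) = \tr (V *m P *m V).
  by rewrite [RHS]mxtrace_mulC mulmxA.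
have -> : \tr (P *m V *m V) = \tr (V *m P *m V) by rewrite mxtrace_mulC mulmxA.
by ring.
Qed.

Section TensorTrace.
Variables (R : realType) (n m : nat).
Local Notation C := R[i].

Lemma overlap_tens (X Z : 'M[C]_n) (Y : 'M[C]_m) :
  overlap (X *t Y) Z = \tr Y * \tr (X *m Z).
Proof.
rewrite /overlap -mxtraceZ scalemxAl; congr (\tr (_ *m _)).
apply/matrixP => i j; rewrite !mxE mulrC mulr_sumr.
by apply: eq_bigr => l _; rewrite tensmxE.
Qed.

Lemma overlap_sum (I : finType) (F : I -> 'M[C]_(n * m)) (Z : 'M[C]_n) :
  overlap (\sum_i F i) Z = \sum_i overlap (F i) Z.
Proof.
elim/big_rec2: _ => [|i y X _ <-]; last by rewrite overlapDl.
by rewrite -(scale0r (0 : 'M[C]_(n * m))) overlapZl mul0r.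
Qed.

Lemma sum_mxtens_index (F : 'I_(n * m) -> C) :
  \sum_a F a = \sum_i \sum_j F (mxtens_index (i, j)).
Proof.
rewrite pair_bigA (reindex (@mxtens_index n m)) /=.
  by apply: eq_bigr => -[].
exists (@mxtens_unindex n m) => a _; [exact: mxtens_indexK|exact: mxtens_unindexK].
Qed.

(** The partial trace is dual to tensoring with the identity; in this form cyclicity of the trace on
    the joint space becomes available. *)
Lemma overlapE (M : 'M[C]_(n * m)) (X : 'M[C]_n) :
  overlap M X = \tr (M *m (X *t 1%:M)).
Proof.
rewrite /overlap /mxtrace sum_mxtens_index; apply: eq_bigr => i _.
rewrite mxE; under eq_bigr do rewrite mxE mulr_suml.
rewrite exchange_big /=; apply: eq_bigr => l _.
rewrite mxE sum_mxtens_index; apply: eq_bigr => j _.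
(* The identity on the bath keeps only the term with equal bath indices. *)
rewrite (bigD1 l) //= tensmxE !mxE eqxx mulr1 big1 ?addr0 // => k kl.
by rewrite tensmxE !mxE (negPf kl) !mulr0.
Qed.

Lemma ketbra_tens (psi : 'cV[C]_n) (phi : 'cV[C]_m) :
  ketbra (psi *t phi : 'cV[C]_(n * m)) = ketbra psi *t ketbra phi.
Proof.
rewrite /ketbra -tensmx_mul; congr (_ *m _).
by apply/matrixP => i j; rewrite !mxE rmorphM.
Qed.

Lemma herm_adj l (M : 'M[C]_l) : M \is hermsymmx -> M ^t* = M.
Proof. by move/is_hermitianmxP; rewrite expr0 scale1r => <-. Qed.

Lemma adj_herm l (M : 'M[C]_l) : M ^t* = M -> M \is hermsymmx.
Proof. by move=> ME; apply/is_hermitianmxP; rewrite expr0 scale1r ME. Qed.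

Lemma expect_ketbra l (psi : 'cV[C]_l) (X Y : 'M[C]_l) :
  expect psi (X *m ketbra psi *m Y) = expect psi X * expect psi Y.
Proof.
rewrite /expect /braket /ketbra.
have -> : psi ^t* *m (X *m (psi *m psi ^t*) *m Y *m psi) =
  (psi ^t* *m (X *m psi)) *m (psi ^t* *m (Y *m psi)) by rewrite !mulmxA.
by rewrite [LHS]mxE big_ord1.
Qed.

Lemma adj_tens (X : 'M[C]_n) (Y : 'M[C]_m) : (X *t Y) ^t* = X ^t* *t Y ^t*.
Proof. by rewrite trmx_tens map_mxT. Qed.

(** Conjugation turns a Hermitian matrix into its transpose, and the trace is invariant under
    transposition and cyclic exchange. *)
Lemma trace_mul_herm_real l (M N : 'M[C]_l) : M ^t* = M -> N ^t* = N ->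
  \tr (M *m N) \is Num.real.
Proof.
move=> ME NE; apply/CrealP; rewrite -(trace_map_mx Num.conj) map_mxM.
have conjE A : A ^t* = A -> map_mx Num.conj A = A^T :> 'M[C]_l.
  by move=> AE; rewrite -[in RHS]AE map_trmx trmxK.
by rewrite (conjE _ ME) (conjE _ NE) -trmx_mul mxtrace_tr mxtrace_mulC.
Qed.

Lemma trace_overlap1 (M : 'M[C]_(n * m)) : \tr M = overlap M 1%:M.
Proof.
rewrite /overlap mulmx1 /mxtrace sum_mxtens_index.
by apply: eq_bigr => i _; rewrite mxE.
Qed.

(** The case Q = p (x) 1 of [trace_double_commutator]: it absorbs [P] on both sides because p is
    idempotent. *)
Lemma overlap_commutator2 (V : 'M[C]_(n * m)) (psi : 'cV[C]_n) (phi : 'cV[C]_m)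
    (P := ketbra psi *t ketbra phi) : unit_vector psi ->
  overlap (commutator V (commutator V P)) (ketbra psi) =
  2 * (\tr (V *m P *m V) - overlap (V *m P *m V) (ketbra psi)).
Proof.
move=> psi1; rewrite !overlapE; apply: trace_double_commutator.
  by rewrite tensmx_mul ketbra_idem // mulmx1.
by rewrite tensmx_mul ketbra_idem // mul1mx.
Qed.

(** In the expansion of V P V^dagger the pair (a, b) carries the bath factor <B_b^dagger B_a>. The
    full trace gives the system factor <S_b^dagger S_a>, the overlap with p the product
    <S_b^dagger><S_a>, and their difference is the covariance. *)
Lemma trace_Bmx_Smx (k : nat) (psi : 'cV[C]_n) (phi : 'cV[C]_m)
    (S : 'I_k -> 'M[C]_n) (B : 'I_k -> 'M[C]_m)
    (V := \sum_a S a *t B a) (P := ketbra psi *t ketbra phi) :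
  \tr (Bmx phi B *m (Smx psi S)^T) =
  \tr (V *m P *m V ^t*) - overlap (V *m P *m V ^t*) (ketbra psi).
Proof.
have VPV : V *m P *m V ^t* = \sum_b \sum_a
    (S a *m ketbra psi *m (S b) ^t*) *t (B a *m ketbra phi *m (B b) ^t*).
  rewrite /V /P !mulmx_suml exchange_big /=; apply: eq_bigr => a _.
  rewrite raddf_sum /= raddf_sum /= mulmx_sumr; apply: eq_bigr => b _.
  by rewrite -/(map_mx _ _) adj_tens !tensmx_mul.
(* The full trace is the overlap with [1%:M], so both terms expand over the same double sum. *)
rewrite VPV (trace_overlap1 (\sum_b _)) !overlap_sum -sumrB [LHS]/mxtrace.
apply: eq_bigr => b _; rewrite mxE !overlap_sum -sumrB; apply: eq_bigr => a _.
rewrite !overlap_tens mulmx1 -mulrBr !mxE; congr (_ * (_ - _)).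
- by rewrite [RHS]mxtrace_mulC mulmxA trace_ketbra.
- by rewrite [RHS]mxtrace_mulC mulmxA trace_ketbra.
- by rewrite trace_ketbra expect_ketbra mulrC.
Qed.

End TensorTrace.

(** * The second time derivative as a polynomial in the coupling *)

(** The second derivative of the quadratic is 2 c, which the prefactor -1/4 turns into -c/2. Viewing
    it as a formal polynomial supplies all the differentiability claims. *)
Lemma susceptibility_quadratic (R : realType) (F : R -> R -> R) (a b c : R) :
  d2dt2_at0 F = (fun eps => a + b * eps + c * eps ^+ 2) ->
  [/\ forall eps, derivable (d2dt2_at0 F) eps 1,
      derivable (derive1 (d2dt2_at0 F)) 0 1 &
      susceptibility F = - 2^-1 * c].
Proof.
move=> FE; pose q := a%:P + b *: 'X + c *: 'X^2.
have qE : d2dt2_at0 F = horner q.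
  by rewrite FE; apply/funext => e; rewrite !hornerE.
rewrite /susceptibility qE derive1nS derive1n1; split.
- by move=> e; exact: derivable_horner.
- by rewrite -derivE; exact: derivable_horner.
- have d1 : (1 : {poly R})^`() = 0 by exact: derivC.
  rewrite -!derivE /q !derivD !derivZ derivC derivX derivXn !derivMn derivX d1.
  rewrite deriv0 scaler0 !add0r hornerZ hornerMn -(polyC1 R) hornerC.
  by field.
Qed.

Section Susceptibility.
Variables (R : realType) (n m : nat).
Variables (HS : 'M[R[i]]_n) (H0 V : 'M[R[i]]_(n * m)).
Variables (phi0 : 'cV[R[i]]_m) (psi : 'cV[R[i]]_n).
Hypotheses (HS_herm : HS \is hermsymmx) (H0_herm : H0 \is hermsymmx).
Hypotheses (V_herm : V \is hermsymmx) (psi_unit : unit_vector psi).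
Hypothesis dfs : forall t, 0 <= t ->
  system_state H0 psi phi0 t = evolve HS (ketbra psi) t.

Let F := dynamical_fidelity H0 V psi phi0.
Let p := ketbra psi.
Let P := ketbra psi *t ketbra phi0.
Let H (eps : R) := H0 + eps%:C *: V.
Let dFdt (eps t : R) := - 'i *
  (overlap (commutator (H eps) (evolve (H eps) P t)) (evolve HS p t)
   + overlap (evolve (H eps) P t) (commutator HS (evolve HS p t))).

Lemma perturbed_herm eps : H eps \is hermsymmx.
Proof.
apply: adj_herm; rewrite /H linearD map_mxD linearZ /= map_mxZ.
rewrite (herm_adj H0_herm) (herm_adj V_herm); congr (_ + _ *: _).
exact: conjc_real.
Qed.

(** Decoherence freedom keeps the unperturbed system state pure, so [fidelity_ketbra] removes the
    square roots. The right-hand side is differentiable at every real [t], as [cvg_derive_ge0]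
    requires. *)
Lemma dynamical_fidelity_overlap eps t : 0 <= t ->
  F eps t = complex.Re (overlap (evolve (H eps) P t) (evolve HS p t)).
Proof.
move=> t0; rewrite /F /dynamical_fidelity (dfs t0) (evolve_ketbra psi t HS_herm).
rewrite (fidelity_ketbra _ (propagator_unit_vector t HS_herm psi_unit)).
by rewrite -(evolve_ketbra psi t HS_herm) /system_state ketbra_tens.
Qed.

Lemma derive_ge0_dynamical_fidelity eps t : 0 <= t ->
  derivable_ge0 (F eps) t /\ derive_ge0 (F eps) t = complex.Re (dFdt eps t).
Proof.
move=> t0; have [dG _] :=
  is_cderive_overlap_evolve P p (perturbed_herm eps) HS_herm t.
by split; [apply: derivable_ge0_is_derive dG|apply: derive_ge0_is_derive dG];
  move=> // s s0; exact: dynamical_fidelity_overlap.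
Qed.

Let d2F (X : 'M[R[i]]_(n * m)) := - (overlap (commutator X (commutator X P)) p
  + 2 * overlap (commutator X P) (commutator HS p)
  + overlap P (commutator HS (commutator HS p))).

Lemma derive2_ge0_dynamical_fidelity eps :
  derivable_ge0 (derive_ge0 (F eps)) 0 /\
  d2dt2_at0 F eps = complex.Re (d2F (H eps)).
Proof.
have [dG _] := is_cderive2_overlap_evolve P p (perturbed_herm eps) HS_herm 0.
have dFE s : 0 <= s -> derive_ge0 (F eps) s = complex.Re (dFdt eps s).
  by move=> s0; have [] := derive_ge0_dynamical_fidelity eps s0.
split; first exact: (derivable_ge0_is_derive (lexx 0) dFE dG).
rewrite /d2dt2_at0 (derive_ge0_is_derive (lexx 0) dFE dG).
rewrite (evolve0 _ (perturbed_herm eps)) (evolve0 _ HS_herm).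
by [].
Qed.

(** The generator enters [d2F] at most twice and always linearly. The coefficient [b] collects the
    terms with one factor V; its value disappears under two derivatives in [eps]. *)
Lemma d2F_quadratic : exists b, forall eps : R,
  d2F (H eps) = d2F H0 + eps%:C * b
    - eps%:C ^+ 2 * overlap (commutator V (commutator V P)) p.
Proof.
exists (- (overlap (commutator H0 (commutator V P)) p
  + overlap (commutator V (commutator H0 P)) p
  + 2 * overlap (commutator V P) (commutator HS p))) => eps.
rewrite /d2F /H !(commutatorDl, commutatorDr, commutatorZl, commutatorZr).
(* Commutators, and then overlaps, become atoms, which leaves a polynomial identity. *)
do ![move: (commutator _ _) => ?].
rewrite !(overlapDl, overlapZl).
do ![move: (overlap _ _) => ?].
by ring.
Qed.

Lemma dynamical_fidelity_susceptibility :
  susceptibility_exists F /\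
  susceptibility F =
    2^-1 * complex.Re (overlap (commutator V (commutator V P)) p).
Proof.
have [b bE] := d2F_quadratic.
have F2 : d2dt2_at0 F = (fun eps => complex.Re (d2F H0) + complex.Re b * eps
    + - complex.Re (overlap (commutator V (commutator V P)) p) * eps ^+ 2).
  apply/funext => eps; have [_ ->] := derive2_ge0_dynamical_fidelity eps.
  (* As [eps] is real, taking real parts acts on each coefficient separately. *)
  rewrite bE -rmorphXn /=.
  move: (d2F H0) (overlap _ _) => [x ?] [y ?] /=; case: (b) => z ? /=.
  by ring.
have [dF ddF ->] := susceptibility_quadratic F2.
split; last by rewrite mulrN mulNr opprK.
split.
- near=> eps; near=> t => t0.
  by have [] := derive_ge0_dynamical_fidelity eps t0.
- by near=> eps; have [] := derive2_ge0_dynamical_fidelity eps.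
- by near=> eps; exact: dF.
- exact: ddF.
Unshelve. all: by end_near. Qed.

End Susceptibility.

Theorem mainTheorem2 (R : realType) (n m k : nat)
    (HS : 'M[R[i]]_n) (HB : 'M[R[i]]_m) (HSB H0 V : 'M[R[i]]_(n * m))
    (S : 'I_k -> 'M[R[i]]_n) (B : 'I_k -> 'M[R[i]]_m)
    (phi0 : 'cV[R[i]]_m) (psi : 'cV[R[i]]_n) (D : {vspace 'cV[R[i]]_n})
    (HS_herm : HS \is hermsymmx) (HB_herm : HB \is hermsymmx)
    (HSB_herm : HSB \is hermsymmx)
    (H0_def : H0 = HS *t 1%:M + 1%:M *t HB + HSB)
    (V_herm : V \is hermsymmx)
    (V_def : V = \sum_(a < k) S a *t B a)
    (phi0_unit : unit_vector phi0) (psi_unit : unit_vector psi)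
    (D_dfs : decoherence_free HS H0 phi0 D) (psi_D : psi \in D) :
  susceptibility_exists (dynamical_fidelity H0 V psi phi0) /\
  (susceptibility (dynamical_fidelity H0 V psi phi0))%:C
    = \tr (Bmx phi0 B *m (Smx psi S)^T).
Proof.
have dfs t : 0 <= t ->
    system_state H0 psi phi0 t = evolve HS (ketbra psi) t.
  by move=> t0; have [] := D_dfs _ psi_D psi_unit t t0.
have H0_herm : H0 \is hermsymmx.
  apply: adj_herm; rewrite H0_def !linearD !map_mxD !adj_tens.
  rewrite (herm_adj HS_herm) (herm_adj HB_herm) (herm_adj HSB_herm).
  by rewrite !trmx1 !map_mx1.
have [Fex ->] :=
  dynamical_fidelity_susceptibility HS_herm H0_herm V_herm psi_unit dfs.
split; first exact: Fex.
(* Hermiticity of V identifies V P V^dagger in [trace_Bmx_Smx] with the V P V of the double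
   commutator. *)
rewrite (overlap_commutator2 _ _ psi_unit) trace_Bmx_Smx -V_def (herm_adj V_herm).
set W := V *m _ *m V.
have W_adj : W ^t* = W.
  by rewrite /W !trmx_mul !map_mxM adj_tens !ketbra_adj (herm_adj V_herm) mulmxA.
(* The susceptibility is a real part, so the complex trace formula matches it only once its value is
   known to be real. *)
have : \tr W - overlap W (ketbra psi) \is Num.real.
  rewrite overlapE rpredB //.
    by rewrite -[W]mulmx1 trace_mul_herm_real // trmx1 map_mx1.
  by rewrite trace_mul_herm_real // adj_tens ketbra_adj trmx1 map_mx1.
move: (\tr W - _) => [x y]; rewrite complex_real => /eqP ->.
(* The factor 1/2 of the susceptibility cancels the 2 from [overlap_commutator2]. *)
by rewrite Re_mul /= mulr0 subr0; congr (_ +i* _); field.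
Qed.
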